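(* Let $(M^n,g)$, $n\ge3$, be a gradient Einstein-type manifold with both $\beta$ and $\mu$ nonzero; that is, there are smooth functions $f,\lambda:M^n\to\mathbb{R}$ and constants $\alpha,\beta,\mu,\rho\in\mathbb{R}$ with $\beta,\mu\neq0$ such that $$\alpha\, Ric+\beta\,\nabla^2 f+\mu\, df\otimes df=(\rho S+\lambda)g .$$ Let $u=e^{\frac{\mu}{\beta}f}$ and $\mathring{Ric}=Ric-\frac{S}{n}g$. Then $$\mathrm{div}\big(\mathring{Ric}(\nabla u)\big)=\frac{n-2}{2n}\mathscr{L}_{\nabla u}S-\frac{\alpha\mu}{\beta^2}\,u\,\|\mathring{Ric}\|^2 .$$
   Context: All manifolds $(M^n,g)$ are connected smooth Riemannian manifolds of dimension $n\ge3$; $Ric$ and $S$ denote the Ricci tensor and the (not necessarily constant) scalar curvature, and $\nabla^2 f$ the Hessian of $f$. $\mathring{Ric}(\nabla u)$ is the vector field obtained by applying to $\nabla u$ the $(1,1)$-tensor metrically equivalent to $\mathring{Ric}$, $\|\mathring{Ric}\|$ is the norm of the tensor $\mathring{Ric}$ induced by $g$ (Hilbert–Schmidt norm), and $\mathscr{L}_{\nabla u}S=\langle\nabla u,\nabla S\rangle$ is the Lie derivative of $S$ along $\nabla u$. *)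

(* Defs.v *)
(* MathComp-Analysis does not provide manifolds: they are given here by smooth
   atlases, and tensor fields by their components in charts.  The coordinates
   of a point of an n-dimensional chart form a row vector in 'rV[R]_n. *)
From HB Require Import structures.
From mathcomp Require Import all_boot all_order all_algebra.
From mathcomp Require Import all_classical all_reals all_analysis.

Set Implicit Arguments.
Unset Strict Implicit.
Unset Printing Implicit Defensive.

Import Order.TTheory GRing.Theory Num.Theory.
Import numFieldNormedType.Exports.
Local Open Scope classical_set_scope.
Local Open Scope ring_scope.

Section Smoothness.
Context {R : realType} {n : nat}.

Definition partial (i : 'I_n) (f : 'rV[R]_n -> R) : 'rV[R]_n -> R :=
  fun x => 'D_(delta_mx 0 i) f x.

(* All partial derivatives of order <= k exist and are continuous at every
   point of U; used only for open sets U. *)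
Fixpoint Ck_on (k : nat) (U : set 'rV[R]_n) (f : 'rV[R]_n -> R) : Prop :=
  (forall x, U x -> {for x, continuous f}) /\
  (if k is k'.+1 then
     forall i : 'I_n,
       (forall x, U x -> derivable f x (delta_mx 0 i)) /\
       Ck_on k' U (partial i f)
   else True).

Definition smooth_on (U : set 'rV[R]_n) (f : 'rV[R]_n -> R) : Prop :=
  forall k, Ck_on k U f.

End Smoothness.

(* The atlas need not be maximal.  The values of [chart_coord a] outside
   [chart_dom a], and of [chart_point a] outside the image of [chart_dom a],
   are irrelevant. *)
Record smoothManifold (R : realType) (n : nat) := SmoothManifold {
  carrier :> topologicalType;
  manifold_hausdorff : hausdorff_space carrier;
  manifold_second_countable : @second_countable carrier;
  chart : Type;
  chart_dom : chart -> set carrier;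
  chart_coord : chart -> carrier -> 'rV[R]_n;
  chart_point : chart -> 'rV[R]_n -> carrier;
  dom_open : forall a, open (chart_dom a);
  dom_cover : forall p, exists a, chart_dom a p;
  image_open : forall a, open (chart_coord a @` chart_dom a);
  coordK : forall a p, chart_dom a p -> chart_point a (chart_coord a p) = p;
  coord_continuous : forall a p, chart_dom a p ->
    {for p, continuous (chart_coord a)};
  point_of_continuous : forall a x, (chart_coord a @` chart_dom a) x ->
    {for x, continuous (chart_point a)};
  transition_smooth : forall a b (i : 'I_n),
    smooth_on (chart_coord a @` (chart_dom a `&` chart_dom b))
      (fun x => chart_coord b (chart_point a x) 0 i)
}.

Section Manifold.
Context {R : realType} {n : nat}.

Definition in_chart (M : smoothManifold R n) (f : M -> R) (a : chart M) :
  'rV[R]_n -> R := fun x => f (chart_point a x).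

Definition smooth_function (M : smoothManifold R n) (f : M -> R) : Prop :=
  forall a : chart M, smooth_on (chart_coord a @` chart_dom a) (in_chart f a).

(* [metric g a x] is the matrix of the components g_ij, in the chart a, at the
   point of coordinates x.  In [metric_compat], 'J is the matrix of the
   partial derivatives dy^k/dx^i (row i, column k), so this is
   g_ij = dy^k/dx^i dy^l/dx^j g'_kl. *)
Record riemannianMetric (M : smoothManifold R n) := RiemannianMetric {
  metric :> chart M -> 'rV[R]_n -> 'M[R]_n;
  metric_smooth : forall a i j,
    smooth_on (chart_coord a @` chart_dom a) (fun x => metric a x i j);
  metric_sym : forall a x, (chart_coord a @` chart_dom a) x ->
    (metric a x)^T = metric a x;
  metric_posdef : forall a x, (chart_coord a @` chart_dom a) x ->
    forall v : 'rV[R]_n, v != 0 -> 0 < (v *m metric a x *m v^T) 0 0;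
  metric_compat : forall (a b : chart M) p, chart_dom a p -> chart_dom b p ->
    let J := 'J (fun x => chart_coord b (chart_point a x)) (chart_coord a p) in
    metric a (chart_coord a p) = J *m metric b (chart_coord b p) *m J^T
}.

End Manifold.

(* Riemannian geometry in coordinates: g is the matrix field of a metric on an
   open subset of R^n. *)
Section Coordinates.
Context {R : realType} {n : nat}.
Implicit Types (g h : 'rV[R]_n -> 'M[R]_n) (f : 'rV[R]_n -> R).
Implicit Types (X : 'rV[R]_n -> 'rV[R]_n) (x : 'rV[R]_n).

(* Gamma^k_ij *)
Definition christoffel g (k i j : 'I_n) : 'rV[R]_n -> R := fun x =>
  2^-1 * \sum_l invmx (g x) k l *
    (partial i (fun y => g y j l) x + partial j (fun y => g y i l) x
     - partial l (fun y => g y i j) x).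

(* dx^l (R(d_i, d_j) d_k), with R(X,Y) = [nabla_X, nabla_Y] - nabla_[X,Y] *)
Definition riemann g (l k i j : 'I_n) : 'rV[R]_n -> R := fun x =>
  partial i (christoffel g l j k) x - partial j (christoffel g l i k) x
  + \sum_p (christoffel g l i p x * christoffel g p j k x
            - christoffel g l j p x * christoffel g p i k x).

(* Ric(Y,Z) = tr (X |-> R(X,Y)Z), positive on round spheres *)
Definition ricci g : 'rV[R]_n -> 'M[R]_n := fun x =>
  \matrix_(j, k) \sum_i riemann g i k i j x.

Definition scalar_curvature g : 'rV[R]_n -> R := fun x =>
  \sum_i \sum_j invmx (g x) i j * ricci g x i j.

Definition traceless_ricci g : 'rV[R]_n -> 'M[R]_n := fun x =>
  ricci g x - (scalar_curvature g x / n%:R) *: g x.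

Definition differential f : 'rV[R]_n -> 'rV[R]_n := fun x =>
  \row_i partial i f x.

Definition differential_sq f : 'rV[R]_n -> 'M[R]_n := fun x =>
  (differential f x)^T *m differential f x.

Definition hessian g f : 'rV[R]_n -> 'M[R]_n := fun x =>
  \matrix_(i, j) (partial i (partial j f) x
                  - \sum_k christoffel g k i j x * partial k f x).

Definition gradient g f : 'rV[R]_n -> 'rV[R]_n := fun x =>
  \row_i \sum_j invmx (g x) i j * partial j f x.

(* The (1,1)-tensor metrically equivalent to h, applied to X. *)
Definition apply_sharp g h X : 'rV[R]_n -> 'rV[R]_n := fun x =>
  \row_i \sum_j \sum_k invmx (g x) i j * h x j k * X x 0 k.

(* tr (nabla X) *)
Definition divergence g X : 'rV[R]_n -> R := fun x =>
  \sum_i (partial i (fun y => X y 0 i) x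
          + \sum_j christoffel g i i j x * X x 0 j).

Definition lie_derivative X f : 'rV[R]_n -> R := fun x =>
  \sum_i X x 0 i * partial i f x.

Definition tensor_inner g (h1 h2 : 'rV[R]_n -> 'M[R]_n) : 'rV[R]_n -> R :=
  fun x => \sum_i \sum_j \sum_k \sum_l
    invmx (g x) i k * invmx (g x) j l * h1 x i j * h2 x k l.

Definition tensor_norm g h : 'rV[R]_n -> R := fun x =>
  Num.sqrt (tensor_inner g h h x).

End Coordinates.

Definition gradient_einstein_type (R : realType) (n : nat)
    (M : smoothManifold R n) (g : riemannianMetric M)
    (f lambda : M -> R) (alpha beta mu rho : R) : Prop :=
  forall (a : chart M) (p : M), chart_dom a p ->
    let x := chart_coord a p in
    alpha *: ricci (g a) x + beta *: hessian (g a) (in_chart f a) x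
      + mu *: differential_sq (in_chart f a) x
    = (rho * scalar_curvature (g a) x + lambda p) *: g a x.

(* Main.v *)
Require Import Defs.
From HB Require Import structures.
From mathcomp Require Import all_boot all_order all_algebra ring lra.
From mathcomp Require Import all_classical all_reals all_analysis.

Set Implicit Arguments.
Unset Strict Implicit.
Unset Printing Implicit Defensive.

Import Order.TTheory GRing.Theory Num.Theory.
Import numFieldNormedType.Exports.
Local Open Scope classical_set_scope.
Local Open Scope ring_scope.

(* With E the traceless Ricci tensor,
   div(E(grad u)) = (div E)(grad u) + <E, Hess u>.  The contracted second
   Bianchi identity gives div E = (1/2 - 1/n) dS.  The exponential makes the
   Einstein-type equation linear in u:
   Hess u = (mu / beta^2) u ((rho S + lambda) g - alpha Ric), and since E is
   trace-free, only -alpha E survives in <E, Hess u>.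

   Everything is local, and the functions smooth on the image U of a chart form
   a commutative ring on which the partial derivatives are commuting
   derivations.  Over such a ring the connection is a family of matrices A_i and
   the curvature is F_ij = d_i A_j - d_j A_i + [A_i, A_j], so that the Bianchi
   identities are matrix algebra with no differentiability side conditions. *)

(** * Riemannian geometry over a ring with commuting derivations *)

Section DifferentialRing.
Context (K : comPzRingType) (n : nat) (d : 'I_n -> K -> K).
Context (dD : forall i a b, d i (a + b) = d i a + d i b).
Context (dM : forall i a b, d i (a * b) = d i a * b + a * d i b).
Context (dC : forall i j a, d i (d j a) = d j (d i a)).

Lemma der0 i : d i 0 = 0.
Proof. by apply: (addrI (d i 0)); rewrite -dD !addr0. Qed.

Lemma derN i a : d i (- a) = - d i a.
Proof. by apply: (addrI (d i a)); rewrite -dD !subrr der0. Qed.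

Lemma der1 i : d i 1 = 0.
Proof.
by apply: (addrI (d i 1)); rewrite addr0 -{3}(mulr1 1) dM mulr1 mul1r.
Qed.

Lemma der_sum i (I : Type) (r : seq I) (P : pred I) (F : I -> K) :
  d i (\sum_(k <- r | P k) F k) = \sum_(k <- r | P k) d i (F k).
Proof. by apply: (big_morph (d i) (dD i) (der0 i)). Qed.

Definition dmx i m p (A : 'M[K]_(m, p)) : 'M[K]_(m, p) := map_mx (d i) A.

Lemma dmxE i m p (A : 'M[K]_(m, p)) r c : dmx i A r c = d i (A r c).
Proof. by rewrite mxE. Qed.

Lemma trmxE m p (A : 'M[K]_(m, p)) r c : A^T r c = A c r.
Proof. by rewrite mxE. Qed.

Lemma dmxD i m p (A B : 'M[K]_(m, p)) : dmx i (A + B) = dmx i A + dmx i B.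
Proof. by apply/matrixP => r c; rewrite !mxE dD. Qed.

Lemma dmxN i m p (A : 'M[K]_(m, p)) : dmx i (- A) = - dmx i A.
Proof. by apply/matrixP => r c; rewrite !mxE derN. Qed.

Lemma dmxM i m p q (A : 'M[K]_(m, p)) (B : 'M[K]_(p, q)) :
  dmx i (A *m B) = dmx i A *m B + A *m dmx i B.
Proof.
apply/matrixP => r c; rewrite !mxE der_sum -big_split /=.
by apply: eq_bigr => k _; rewrite dM !mxE.
Qed.

Lemma dmx_tr i m p (A : 'M[K]_(m, p)) : dmx i A^T = (dmx i A)^T.
Proof. by apply/matrixP => r c; rewrite !mxE. Qed.

Lemma dmxC i j m p (A : 'M[K]_(m, p)) : dmx i (dmx j A) = dmx j (dmx i A).
Proof. by apply/matrixP => r c; rewrite !mxE dC. Qed.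

Lemma addmxE m p (A B : 'M[K]_(m, p)) r c : (A + B) r c = A r c + B r c.
Proof. by rewrite mxE. Qed.

Lemma oppmxE m p (A : 'M[K]_(m, p)) r c : (- A) r c = - A r c.
Proof. by rewrite mxE. Qed.

Lemma scalemxE m p (a : K) (A : 'M[K]_(m, p)) r c : (a *: A) r c = a * A r c.
Proof. by rewrite mxE. Qed.

Lemma mulmx_sumE m p q (A : 'M[K]_(m, p)) (B : 'M[K]_(p, q)) r c :
  (A *m B) r c = \sum_k A r k * B k c.
Proof. by rewrite mxE. Qed.

(** * The Levi-Civita connection of a metric over the ring *)

Context (G H : 'M[K]_n) (half : K).
Context (half2 : half + half = 1) (Gsym : G^T = G) (GH : G *m H = 1%:M).

Lemma halfK (a : K) : half * a + half * a = a.
Proof. by rewrite -mulrDl half2 mul1r. Qed.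

(** The element [half] stands in for characteristic different from 2: it turns each relation $a =
    -a$ coming from an antisymmetry into vanishing. *)
Lemma addrr_eq0 (a : K) : a + a = 0 -> a = 0.
Proof. by move=> aa; rewrite -(halfK a) -mulrDr aa mulr0. Qed.

Lemma GsymE i j : G i j = G j i.
Proof. by rewrite -{1}Gsym mxE. Qed.

Lemma HG : H *m G = 1%:M.
Proof. by apply: mulmx1C. Qed.

Lemma Hsym : H^T = H.
Proof.
by rewrite -[H^T]mulmx1 -GH mulmxA -{1}Gsym -trmx_mul GH trmx1 mul1mx.
Qed.

(* [conn i] is the matrix (l, k) |-> Gamma^l_ik. *)
Definition conn i : 'M[K]_n := \matrix_(l, k)
  (half * \sum_m H l m * (d i (G k m) + d k (G i m) - d m (G i k))).

Lemma conn_sym i l k : conn i l k = conn k l i.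
Proof.
rewrite !mxE; congr (_ * _); apply: eq_bigr => m _; congr (_ * _).
by rewrite (GsymE k i); ring.
Qed.

(** Lowering the upper index gives the Christoffel symbols of the first kind, from which the inverse
    metric has disappeared. *)
Lemma G_conn i m k :
  (G *m conn i) m k = half * (d i (G k m) + d k (G i m) - d m (G i k)).
Proof.
pose v : 'cV[K]_n := \col_m (half * (d i (G k m) + d k (G i m) - d m (G i k))).
have -> : (G *m conn i) m k = (G *m (H *m v)) m 0.
  rewrite !mxE; apply: eq_bigr => l _; congr (_ * _); rewrite !mxE mulr_sumr.
  by apply: eq_bigr => p _; rewrite !mxE; ring.
by rewrite mulmxA GH mul1mx mxE.
Qed.

(** This is $\nabla g = 0$: in the sum of two first-kind symbols everything cancels except two
    copies of $d_i g_{mk}$, which [half] merges. *)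
Lemma metric_compatibility i : dmx i G = (conn i)^T *m G + G *m conn i.
Proof.
have -> : (conn i)^T *m G = (G *m conn i)^T by rewrite trmx_mul Gsym.
apply/matrixP => m k; rewrite addmxE trmxE dmxE addrC !G_conn -mulrDr.
have -> : d i (G k m) + d k (G i m) - d m (G i k)
    + (d i (G m k) + d m (G i k) - d k (G i m)) = d i (G m k) + d i (G m k).
  by rewrite (GsymE k m); ring.
by rewrite mulrDr halfK.
Qed.

(** The inverse metric is parallel too: differentiate [G *m H = 1%:M] and solve for [dmx i H]. *)
Lemma dmx_inverse i : dmx i H = - (conn i *m H + H *m (conn i)^T).
Proof.
have : dmx i (G *m H) = 0.
  apply/matrixP => r c; rewrite GH !mxE.
  by case: (r == c); rewrite ?mulr0n ?mulr1n ?der0 ?der1.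
rewrite dmxM => /(congr1 (mulmx H)).
rewrite mulmx0 mulmxDr [H *m (G *m _)]mulmxA HG mul1mx => /eqP.
rewrite addrC addr_eq0 => /eqP ->; congr (- _).
rewrite metric_compatibility mulmxDl mulmxDr -mulmxA GH mulmx1.
by rewrite addrC !mulmxA HG mul1mx.
Qed.

(** * Curvature and its symmetries *)

Definition curv i j : 'M[K]_n :=
  dmx i (conn j) - dmx j (conn i) + (conn i *m conn j - conn j *m conn i).

Lemma curvE i j l k :
  curv i j l k = d i (conn j l k) - d j (conn i l k)
    + (\sum_p conn i l p * conn j p k - \sum_p conn j l p * conn i p k).
Proof.
by rewrite /curv !(addmxE, oppmxE) !dmxE; congr (_ + (_ - _)); rewrite mxE.
Qed.

Lemma curv_anti i j : curv j i = - curv i j.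
Proof. by apply/matrixP => r c; rewrite /curv !(addmxE, oppmxE); ring. Qed.

(** Skew-adjointness is the integrability condition of $\nabla g = 0$: expand $d_i d_j G - d_j d_i G
    = 0$ by metric compatibility, twice. *)
Lemma curv_metric_anti i j : (curv i j)^T *m G + G *m curv i j = 0.
Proof.
have E : dmx i (dmx j G) - dmx j (dmx i G) = 0 by rewrite dmxC subrr.
have F : (curv i j)^T = dmx i (conn j)^T - dmx j (conn i)^T
    + ((conn j)^T *m (conn i)^T - (conn i)^T *m (conn j)^T).
  apply/matrixP => r c; rewrite !dmx_tr -!trmx_mul.
  by rewrite /curv !(addmxE, oppmxE, trmxE).
rewrite -[RHS]E !metric_compatibility !dmxD !dmxM !metric_compatibility F /curv.
rewrite !(mulmxDl, mulmxDr, mulmxN, mulNmx, opprD, opprK) !mulmxA.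
by apply/matrixP => r c; rewrite !(addmxE, oppmxE); ring.
Qed.

(** Raising the second matrix index turns skew-adjointness for [G] into plain antisymmetry of the
    matrix. *)
Definition curvH i j : 'M[K]_n := curv i j *m H.

Lemma curvH_tr i j : (curvH i j)^T = - curvH i j.
Proof.
have /(congr1 (fun A => H *m A *m H)) := curv_metric_anti i j.
rewrite mulmx0 mul0mx mulmxDr mulmxDl !mulmxA HG mul1mx -mulmxA GH mulmx1.
by move/eqP; rewrite addr_eq0 => /eqP; rewrite /curvH trmx_mul Hsym.
Qed.

Lemma curvH_antil i j k l : curvH j i k l = - curvH i j k l.
Proof. by rewrite /curvH curv_anti mulNmx oppmxE. Qed.

Lemma curvH_antir i j k l : curvH i j l k = - curvH i j k l.
Proof. by rewrite -trmxE curvH_tr oppmxE. Qed.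

(** Skew-adjointness makes [curv i j] similar to minus its transpose, so its trace is its own
    negative. *)
Lemma curv_trace0 i j : \tr (curv i j) = 0.
Proof.
have e : curv i j = - (H *m (curv i j)^T *m G).
  apply/eqP; rewrite eq_sym eqr_oppLR -addr_eq0 -[X in _ + X]mul1mx -HG.
  by rewrite -!mulmxA -mulmxDr curv_metric_anti mulmx0.
apply: addrr_eq0; rewrite {1}e raddfN /= -mulmxA mxtrace_mulC -mulmxA GH mulmx1.
by rewrite mxtrace_tr addNr.
Qed.

(** Symmetry of the connection in its lower indices makes the derivative terms and the quadratic
    terms cancel in pairs. *)
Lemma bianchi1 i j k l : curv i j l k + curv j k l i + curv k i l j = 0.
Proof.
have S a b c : (conn a *m conn b) l c = (conn a *m conn c) l b.
  by rewrite !mxE; apply: eq_bigr => p _; rewrite (conn_sym b).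
have D a b c : dmx a (conn b) l c = dmx a (conn c) l b.
  by rewrite !dmxE conn_sym.
rewrite /curv !(addmxE, oppmxE) (S i k j) (S j i k) (S k j i).
by rewrite (D i k j) (D j i k) (D k j i); ring.
Qed.

(** The identity $d_A F = 0$ for connection matrices. The terms where the connection would act on
    the form indices are absent: in a cyclic sum they cancel for a torsion-free connection. *)
Lemma bianchi2 m i j :
  (dmx m (curv i j) + conn m *m curv i j - curv i j *m conn m)
  + (dmx i (curv j m) + conn i *m curv j m - curv j m *m conn i)
  + (dmx j (curv m i) + conn j *m curv m i - curv m i *m conn j) = 0.
Proof.
rewrite /curv !(dmxD, dmxN, dmxM) (dmxC m i) (dmxC m j) (dmxC i j).
rewrite !(mulmxDl, mulmxDr, mulmxN, mulNmx, opprD, opprK) !mulmxA.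
by apply/matrixP => r c; rewrite !(addmxE, oppmxE) [RHS]mxE; ring.
Qed.

(** * Ricci curvature and the contracted Bianchi identity *)

Definition ricK : 'M[K]_n := \matrix_(j, k) \sum_i curv i j i k.

(** Setting $l = i$ in [bianchi1] and summing over $i$ gives $Ric_{jk} + tr F_{jk} - Ric_{kj} = 0$
    with $F$ the curvature, and the trace vanishes. *)
Lemma ricK_sym : ricK^T = ricK.
Proof.
apply/matrixP => j k; rewrite !mxE; apply/eqP; rewrite -subr_eq0 -sumrB.
rewrite -[X in _ == X](curv_trace0 j k); apply/eqP/eq_bigr => i _.
apply/eqP; rewrite -subr_eq0 -oppr_eq0 -[X in _ == X](bianchi1 i j k i).
by rewrite (curv_anti i k) !oppmxE; apply/eqP; ring.
Qed.

Definition scalK : K := \sum_i \sum_j H i j * ricK i j.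

Definition ricsharp : 'M[K]_n := H *m ricK.

Lemma curvH_contract j k : \sum_i curvH i j i k = ricsharp k j.
Proof.
rewrite /ricsharp -ricK_sym -{1}Hsym -trmx_mul trmxE mxE.
under eq_bigr do rewrite mxE; rewrite exchange_big; apply: eq_bigr => p _ /=.
by rewrite mxE mulr_suml.
Qed.

Lemma ricsharp_trace : \tr ricsharp = scalK.
Proof.
apply: eq_bigr => i _; rewrite mxE; apply: eq_bigr => j _.
by rewrite -[in RHS]ricK_sym trmxE.
Qed.

(* Twice contracting the second Bianchi identity: in the two terms that give the
   divergence, the Christoffel symbols of the form A_i j p = Gamma^j_ip occur
   contracted with a tensor antisymmetric in (i, p), and so vanish. *)
Lemma contracted_bianchi m :
  half * d m scalK = \sum_i (d i (ricsharp i m)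
    + \sum_p conn i i p * ricsharp p m - \sum_p conn m i p * ricsharp p i).
Proof.
(* [T m i j] is the derivative of [curvH i j] along $d_m$, covariant in the two matrix indices only;
   since [H] is parallel, it inherits [bianchi2]. *)
pose T m i j : 'M[K]_n :=
  dmx m (curvH i j) + conn m *m curvH i j + curvH i j *m (conn m)^T.
have TE a i j : T a i j = (dmx a (curv i j) + conn a *m curv i j
                           - curv i j *m conn a) *m H.
  rewrite /T /curvH dmxM dmx_inverse !(mulmxDl, mulmxDr, mulmxN, mulNmx).
  rewrite !mulmxA.
  by apply/matrixP => r c; rewrite !(addmxE, oppmxE); ring.
have B i j l k : T m i j l k + T i j m l k + T j m i l k = 0.
  by rewrite -!addmxE !TE -!mulmxDl bianchi2 mul0mx mxE.
have TR a i j l k : T a i j l k = d a (curvH i j l k)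
    + \sum_p conn a l p * curvH i j p k + \sum_p curvH i j l p * conn a k p.
  rewrite /T !addmxE dmxE; congr (_ + _ + _); rewrite mxE //.
  by apply: eq_bigr => p _; rewrite trmxE.
have S : \sum_i \sum_j (T m i j i j + T i j m i j + T j m i i j) = 0.
  by apply: big1 => i _; apply: big1 => j _; rewrite B.
(* The right-hand side of the claim is [V - W]; [Z] collects the Christoffel terms that vanish by
   symmetry. *)
pose W := \sum_i \sum_p conn m i p * ricsharp p i.
pose V := \sum_i (d i (ricsharp i m) + \sum_p conn i i p * ricsharp p m).
pose Z := \sum_i \sum_j \sum_p curvH j m i p * conn i j p.
have Z0 : Z = 0.
  apply: addrr_eq0; apply/eqP; rewrite addr_eq0 -sumrN; apply/eqP.
  rewrite /Z; under eq_bigr do rewrite exchange_big /=.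
  rewrite exchange_big /=; apply: eq_bigr => i _; rewrite -sumrN exchange_big.
  apply: eq_bigr => j _; rewrite -sumrN; apply: eq_bigr => p _.
  by rewrite (curvH_antir _ _ i p) conn_sym mulNr.
have sw i j k l : curvH j i l k = curvH i j k l.
  by rewrite curvH_antil curvH_antir opprK.
have E1 : \sum_i \sum_j T m i j i j = d m scalK + (W + W).
  under eq_bigr do (under eq_bigr do rewrite TR); rewrite addrA.
  under eq_bigr do rewrite !big_split /=; rewrite !big_split /=.
  congr (_ + _ + _).
  - rewrite -ricsharp_trace der_sum exchange_big; apply: eq_bigr => j _ /=.
    by rewrite -der_sum curvH_contract.
  - apply: eq_bigr => i _; rewrite exchange_big; apply: eq_bigr => p _ /=.
    by rewrite -mulr_sumr -curvH_contract; congr (_ * _); apply: eq_bigr.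
  - rewrite exchange_big; apply: eq_bigr => j _; rewrite exchange_big.
    by apply: eq_bigr => p _; rewrite -mulr_suml curvH_contract mulrC.
have E2 : \sum_i \sum_j T i j m i j = Z - V.
  under eq_bigr do (under eq_bigr do rewrite TR).
  under eq_bigr do rewrite !big_split /=; rewrite !big_split /= addrC.
  congr (_ + _); rewrite -big_split -sumrN; apply: eq_bigr => i _ /=.
  rewrite opprD; congr (_ + _).
    rewrite -der_sum -derN -curvH_contract -sumrN; congr (d i _).
    by apply: eq_bigr => j _; rewrite curvH_antir.
  rewrite exchange_big -sumrN; apply: eq_bigr => p _ /=.
  rewrite -mulr_sumr -curvH_contract -mulrN -sumrN; congr (_ * _).
  by apply: eq_bigr => j _; rewrite curvH_antir.
(* Renaming [i] and [j] reduces this sum to that of [E2], because [curvH] is unchanged when both of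
   its index pairs are swapped. *)
have E3 : \sum_i \sum_j T j m i i j = Z - V.
  rewrite -E2 exchange_big; apply: eq_bigr => i _; apply: eq_bigr => j _ /=.
  rewrite !TR sw -!addrA; congr (_ + _).
  by rewrite addrC; congr (_ + _); apply: eq_bigr => p _; rewrite sw mulrC.
have {}S : d m scalK + (W + W) + (Z - V) + (Z - V) = 0.
  rewrite -E1 -{1}E2 -E3 -[RHS]S -!big_split; apply: eq_bigr => i _ /=.
  by rewrite -!big_split.
(* What remains is $d_m S + 2W - 2V = 0$ with $S$ the scalar curvature, twice the claim. *)
rewrite sumrB -/V -/W; rewrite Z0 in S.
apply/eqP; rewrite -subr_eq0; apply/eqP/addrr_eq0.
by rewrite -[RHS]S -{3}(halfK (d m scalK)); ring.
Qed.

(** * Divergence, gradient and Hessian *)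

Definition divK (X : 'cV[K]_n) : K :=
  \sum_i (d i (X i 0) + \sum_j conn i i j * X j 0).

Definition gradK (u : K) : 'cV[K]_n := H *m \col_j d j u.

Definition hessK (u : K) : 'M[K]_n :=
  \matrix_(i, l) (d i (d l u) - \sum_k conn i k l * d k u).

(** The Leibniz rule $div(NX) = (div N)(X) + tr(N \nabla X)$. The Christoffel term subtracted in the
    first summand equals the one added in the second, by [conn_sym]. *)
Lemma divK_mul (N : 'M[K]_n) (X : 'cV[K]_n) :
  divK (N *m X) =
  \sum_k (\sum_i (d i (N i k) + \sum_p conn i i p * N p k
                  - \sum_p conn k i p * N p i)) * X k 0
  + \sum_i (N *m (dmx i X + conn i *m X)) i 0.
Proof.
have E : \sum_i (N *m (conn i *m X)) i 0
    = \sum_k (\sum_i \sum_p conn k i p * N p i) * X k 0.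
  under [RHS]eq_bigr do rewrite mulr_suml.
  rewrite exchange_big /=.
  under [RHS]eq_bigr do under eq_bigr do rewrite mulr_suml.
  under [RHS]eq_bigr do rewrite exchange_big /=.
  rewrite [RHS]exchange_big /=; apply: eq_bigr => p _.
  rewrite mxE; apply: eq_bigr => i _; rewrite mxE mulr_sumr.
  by apply: eq_bigr => k _; rewrite (conn_sym p); ring.
have E1 : \sum_i d i ((N *m X) i 0) = \sum_k (\sum_i d i (N i k)) * X k 0
    + \sum_i (N *m dmx i X) i 0.
  under [X in _ = X + _]eq_bigr do rewrite mulr_suml.
  rewrite exchange_big -big_split; apply: eq_bigr => i _ /=.
  rewrite -dmxE dmxM addmxE mxE; congr (_ + _).
  by apply: eq_bigr => k _; rewrite dmxE.
have E2 : \sum_i \sum_j conn i i j * (N *m X) j 0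
    = \sum_k (\sum_i \sum_p conn i i p * N p k) * X k 0.
  under [RHS]eq_bigr do rewrite mulr_suml.
  rewrite [RHS]exchange_big; apply: eq_bigr => i _ /=.
  under [RHS]eq_bigr do rewrite mulr_suml.
  rewrite [RHS]exchange_big; apply: eq_bigr => p _ /=.
  by rewrite [(N *m X) p 0]mxE mulr_sumr; apply: eq_bigr => k _; rewrite mulrA.
under [X in _ = _ + X]eq_bigr do rewrite mulmxDr addmxE.
under [X in _ = X + _]eq_bigr do rewrite sumrB big_split /= mulrBl mulrDl.
by rewrite /divK sumrB !big_split /= E E1 E2; ring.
Qed.

(** As [H] is parallel, covariant differentiation passes through the raised index of $du$, and
    $\nabla du$ is the Hessian. *)
Lemma gradK_conn u i : dmx i (gradK u) + conn i *m gradK u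
  = H *m (row i (hessK u))^T.
Proof.
have -> : (row i (hessK u))^T
    = dmx i (\col_j d j u) - (conn i)^T *m \col_j d j u.
  apply/matrixP => l z; rewrite !mxE; congr (_ - _).
  by apply: eq_bigr => k _; rewrite !mxE.
rewrite /gradK dmxM dmx_inverse mulmxBr mulNmx mulmxDl !mulmxA.
by apply/matrixP => r c; rewrite !(addmxE, oppmxE); ring.
Qed.

(** Here [ninv] stands for $1/n$. In the divergence of [N], [half] comes from [contracted_bianchi]
    and [- ninv] from differentiating the multiple of the identity. *)
Lemma div_traceless_grad (ninv : K) (u : K) : (forall i, d i ninv = 0) ->
  let N := H *m (ricK - (ninv * scalK) *: G) in
  divK (N *m gradK u) =
  (half - ninv) * (\sum_k gradK u k 0 * d k scalK)
  + \tr (N *m (H *m (hessK u)^T)).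
Proof.
move=> dninv N; rewrite divK_mul; congr (_ + _); last first.
  apply: eq_bigr => i _; rewrite gradK_conn !mxE; apply: eq_bigr => k _.
  by congr (_ * _); rewrite !mxE; apply: eq_bigr => l _; rewrite !mxE.
rewrite mulr_sumr; apply: eq_bigr => k _.
rewrite [X in _ = _ * X]mulrC mulrA; congr (_ * _).
have NE i p : N i p = ricsharp i p - (i == p)%:R * (ninv * scalK).
  by rewrite /N mulmxBr -scalemxAr HG !mxE mulrC.
have dN i : d i (N i k) = d i (ricsharp i k) - (i == k)%:R * (ninv * d i scalK).
  rewrite NE dD derN; congr (_ - _); rewrite !dM dninv mul0r add0r.
  by case: (i == k); rewrite ?der0 ?der1 mul0r add0r.
have S (F : 'I_n -> K) q : \sum_p F p * N p q
    = \sum_p F p * ricsharp p q - F q * (ninv * scalK).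
  under eq_bigr do rewrite NE mulrBr.
  rewrite sumrB; congr (_ - _); rewrite (bigD1 q) //= eqxx mul1r big1 ?addr0 //.
  by move=> p /negPf ->; rewrite mul0r mulr0.
rewrite mulrBl contracted_bianchi.
have -> : ninv * d k scalK = \sum_i (i == k)%:R * (ninv * d i scalK).
  rewrite (bigD1 k) //= eqxx mul1r big1 ?addr0 //.
  by move=> p /negPf ->; rewrite mul0r.
(* The multiple of the identity meets [conn i i k] and [conn k i i], which are equal, so its
   Christoffel terms cancel. *)
rewrite -sumrB; apply: eq_bigr => i _; rewrite dN !S (conn_sym k i); ring.
Qed.

End DifferentialRing.

(** * Symmetry of second derivatives *)

Section DirectionalDerivatives.
Context (R : realType) (n : nat).
Implicit Types (f : 'rV[R]_n -> R) (x y v w : 'rV[R]_n).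

(** Restriction to a line makes the one-variable mean value theorem and chain rule available for
    directional derivatives. *)
Lemma derivable_line f v y (t : R) :
  derivable f (t *: v + y) v <-> derivable (fun s : R => f (s *: v + y)) t 1.
Proof.
rewrite /derivable; set g1 := fun h => h^-1 *: _; set g2 := fun h => h^-1 *: _.
suff -> : g1 = g2 by [].
by apply/funext => h; rewrite /g1 /g2 /= [_%:A]mulr1 scalerDl addrA.
Qed.

Lemma derive_line f v y (t : R) :
  'D_v f (t *: v + y) = 'D_1 (fun s : R => f (s *: v + y)) t.
Proof.
rewrite /derive; set g1 := fun h => h^-1 *: _; set g2 := fun h => h^-1 *: _.
suff -> : g1 = g2 by [].
by apply/funext => h; rewrite /g1 /g2 /= [_%:A]mulr1 scalerDl addrA.
Qed.

Lemma derivable_translate f v c y :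
  derivable f (y + c) v -> derivable (fun z => f (z + c)) y v.
Proof.
rewrite /derivable; set g1 := fun h => h^-1 *: _; set g2 := fun h => h^-1 *: _.
suff -> : g1 = g2 by [].
by apply/funext => h; rewrite /g1 /g2 /= addrA.
Qed.

Lemma derive_translate f v c y : 'D_v (fun z => f (z + c)) y = 'D_v f (y + c).
Proof.
rewrite /derive; set g1 := fun h => h^-1 *: _; set g2 := fun h => h^-1 *: _.
suff -> : g1 = g2 by [].
by apply/funext => h; rewrite /g1 /g2 /= addrA.
Qed.

Lemma mvt_line f v y (s : R) : 0 < s ->
  (forall t, 0 <= t <= s -> derivable f (t *: v + y) v) ->
  exists2 t, 0 <= t <= s & f (s *: v + y) - f y = s * 'D_v f (t *: v + y).
Proof.
move=> s0 df.
have [t t0s e] : exists2 t, t \in `]0, s[%R &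
    f (s *: v + y) - f (0 *: v + y) = 'D_v f (t *: v + y) * (s - 0).
  pose df' (t : R) := 'D_v f (t *: v + y).
  apply: (@MVT R (fun t => f (t *: v + y)) df') => //.
    move=> t; rewrite in_itv => /andP[t0 ts]; rewrite /df' derive_line.
    by apply/derivableP/derivable_line/df; rewrite !ltW.
  apply: derivable_within_continuous => t; rewrite in_itv => ts.
  exact/derivable_line/df.
exists t; first by move: t0s; rewrite in_itv /= => /andP[? ?]; rewrite !ltW.
by move: e; rewrite scale0r add0r subr0 mulrC.
Qed.

(** The mean value theorem is applied along [v] to the increment of [f] by [s *: w], then along [w]
    to ['D_v f]. *)
Lemma mixed_difference f v w x (s : R) : 0 < s ->
  (forall p q, 0 <= p <= s -> 0 <= q <= s ->
     derivable f (p *: v + (q *: w + x)) v /\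
     derivable ('D_v f) (q *: w + (p *: v + x)) w) ->
  exists p q, [/\ 0 <= p <= s, 0 <= q <= s &
    f (s *: v + s *: w + x) - f (s *: v + x) - f (s *: w + x) + f x
    = s ^+ 2 * 'D_w ('D_v f) (q *: w + (p *: v + x))].
Proof.
move=> s0 df; have s00 : 0 <= (0 : R) <= s by rewrite lexx ltW.
have ss : 0 <= s <= s by rewrite lexx ltW.
pose F y := f (y + s *: w) - f y.
have dfw p : 0 <= p <= s -> derivable (fun z => f (z + s *: w)) (p *: v + x) v.
  move=> ps; apply: derivable_translate; rewrite -addrA [x + _]addrC.
  exact: (df p s ps ss).1.
have df0 p : 0 <= p <= s -> derivable f (p *: v + x) v.
  by move=> ps; have := (df p 0 ps s00).1; rewrite scale0r add0r.
have [p ps e1] : exists2 p, 0 <= p <= s &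
    F (s *: v + x) - F x = s * 'D_v F (p *: v + x).
  by apply: mvt_line => // p ps; apply: derivableB; [exact: dfw|exact: df0].
have [q qs e2] := mvt_line s0 (fun q => fun qs => (df p q ps qs).2).
exists p, q; split=> //; transitivity (F (s *: v + x) - F x).
  by rewrite /F -!addrA [x + _]addrC [- f (s *: v + _) + _]addrCA; ring.
rewrite e1 (deriveB (dfw _ ps) (df0 _ ps)) derive_translate expr2 -mulrA -e2.
by rewrite [s *: w + _]addrC.
Qed.

Lemma small_combination (U : set 'rV[R]_n) v w x : nbhs x U ->
  exists2 s : R, 0 < s & forall p q, 0 <= p <= s -> 0 <= q <= s ->
    U (p *: v + (q *: w + x)).
Proof.
move=> /nbhs_normP[e /= e0 eU].
have N0 : 0 < `|v| + `|w| + 1 by rewrite ltr_wpDl// addr_ge0.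
(* The summand 1 keeps the denominator positive even when [v] and [w] vanish; [e / 2] leaves room
   for the strict inequality. *)
exists (e / 2 / (`|v| + `|w| + 1)); first by rewrite !divr_gt0.
set s := _ / _ => p q /andP[p0 ps] /andP[q0 qs]; apply: eU => /=.
rewrite addrA opprD addrCA subrr addr0 normrN.
apply: (le_lt_trans (ler_normD _ _)); rewrite !normrZ !ger0_norm//.
apply: (@le_lt_trans _ _ (e / 2)); last by lra.
have -> : e / 2 = s * `|v| + s * `|w| + s.
  by rewrite -{3}(mulr1 s) -!mulrDr divfK// gt_eqF.
apply: (@le_trans _ _ (s * `|v| + s * `|w|)); first by rewrite lerD// ler_wpM2r.
by rewrite lerDl (le_trans p0 ps).
Qed.

(* Both iterated mean value theorems evaluate the same second difference, so the
   two mixed derivatives take equal values arbitrarily close to x. *)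
Lemma derive_comm f v w x (U : set 'rV[R]_n) : open U -> U x ->
  (forall y, U y -> [/\ derivable f y v, derivable f y w,
     derivable ('D_v f) y w & derivable ('D_w f) y v]) ->
  {for x, continuous ('D_w ('D_v f))} -> {for x, continuous ('D_v ('D_w f))} ->
  'D_w ('D_v f) x = 'D_v ('D_w f) x.
Proof.
move=> oU Ux df c1 c2; apply/eqP/negPn/negP; rewrite -subr_eq0 -normr_gt0.
set a := 'D_w ('D_v f) x; set b := 'D_v ('D_w f) x; set e := `|a - b| => e0.
have e20 : 0 < e / 2 by rewrite divr_gt0.
have /cvgr_dist_lt/(_ _ e20) n1 := c1; have /cvgr_dist_lt/(_ _ e20) n2 := c2.
have nU : nbhs x U by apply: open_nbhs_nbhs.
have [s s0 sU] := small_combination v w (filterI nU (filterI n1 n2)).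
have sw p q : p *: v + (q *: w + x) = q *: w + (p *: v + x) by rewrite addrCA.
have d1 p q : 0 <= p <= s -> 0 <= q <= s ->
    derivable f (p *: v + (q *: w + x)) v /\
    derivable ('D_v f) (q *: w + (p *: v + x)) w.
  move=> ps qs; have [/df[h _ h' _] _] := sU p q ps qs.
  by split; [exact: h|move: h'; rewrite (sw p q); apply].
have d2 q p : 0 <= q <= s -> 0 <= p <= s ->
    derivable f (q *: w + (p *: v + x)) w /\
    derivable ('D_w f) (p *: v + (q *: w + x)) v.
  move=> qs ps; have [/df[_ h _ h'] _] := sU p q ps qs.
  by split; [move: h; rewrite (sw p q); apply|exact: h'].
have [p [q [ps qs E1]]] := mixed_difference s0 d1.
have [q' [p' [qs' ps' E2]]] := mixed_difference s0 d2.
have [_ [h1 _]] := sU p q ps qs; have [_ [_ h2]] := sU p' q' ps' qs'.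
have E : 'D_w ('D_v f) (q *: w + (p *: v + x))
    = 'D_v ('D_w f) (p' *: v + (q' *: w + x)).
  have s2 : s ^+ 2 != 0 by rewrite expf_neq0// gt_eqF.
  have e3 : f (s *: w + s *: v + x) = f (s *: v + s *: w + x).
    by congr (f (_ + _)); apply: addrC.
  have ac (k k' l m r b1 b2 : R) : k' = k ->
      k - l - m + r = b1 -> k' - m - l + r = b2 -> b1 = b2.
    by move=> -> <- <-; ring.
  by apply: (mulfI s2); apply: ac e3 E1 E2.
rewrite -E in h2.
(* The common value would lie within half of the distance from [a] to [b] of both, which the
   triangle inequality forbids. *)
have tri (r t z : R) :
    `|r - z| < `|r - t| / 2 -> `|t - z| < `|r - t| / 2 -> False.
  move=> rz tz; have : `|r - t| < `|r - t| / 2 + `|r - t| / 2.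
    apply: le_lt_trans (ltrD rz tz); rewrite [`|t - z|]distrC.
    by apply: le_trans (ler_normD _ _); rewrite addrA subrK.
  by rewrite -splitr ltxx.
have h1' : `|a - 'D_w ('D_v f) (q *: w + (p *: v + x))| < e / 2.
  by case: _ / (sw p q); exact: h1.
have h2' : `|b - 'D_w ('D_v f) (q *: w + (p *: v + x))| < e / 2.
  exact: h2.
exact: tri h1' h2'.
Qed.

End DirectionalDerivatives.

(** * The differential ring of smooth functions *)

Section SmoothClosure.
Context (R : realType) (n : nat) (U : set 'rV[R]_n) (oU : open U).
Implicit Types (f h : 'rV[R]_n -> R) (x : 'rV[R]_n).

Lemma near_eq_on f h x : U x -> (forall y, U y -> f y = h y) ->
  \forall y \near x, f y = h y.
Proof. by move=> Ux fh; near=> y; apply: fh; near: y; apply: open_nbhs_nbhs.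
Unshelve. all: by end_near. Qed.

Lemma partial_eq_on i f h : (forall y, U y -> f y = h y) ->
  forall y, U y -> partial i f y = partial i h y.
Proof. by move=> fh y Uy; apply: near_eq_derive; apply: near_eq_on. Qed.

(** As [U] is open, derivatives at its points see only values in [U]. A partial derivative may thus
    be replaced by a formula valid only there. *)
Lemma Ck_eq_on k f h :
  (forall y, U y -> f y = h y) -> Ck_on k U f -> Ck_on k U h.
Proof.
elim: k f h => [|k IH] f h fh /= [cf df]; split=> //.
- move=> x Ux; rewrite /prop_for /continuous_at -(fh x Ux).
  exact: cvg_trans (near_eq_cvg (near_eq_on Ux fh)) (cf x Ux).
- move=> x Ux; rewrite /prop_for /continuous_at -(fh x Ux).
  exact: cvg_trans (near_eq_cvg (near_eq_on Ux fh)) (cf x Ux).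
- move=> i; have [df' ck] := df i; split.
    by move=> x Ux; apply: near_eq_derivable (df' x Ux); apply: near_eq_on.
  by apply: IH ck; apply: partial_eq_on.
Qed.

(** The product rule pairs a derivative with an undifferentiated factor, whose order must first be
    lowered to match the induction hypothesis. *)
Lemma Ck_on_pred k f : Ck_on k.+1 U f -> Ck_on k U f.
Proof.
elim: k f => [|k IH] f [cf df]; split=> // i.
by have [df' ck] := df i; split=> //; apply: IH.
Qed.

Lemma Ck_cst k (c : R) : Ck_on k U (cst c).
Proof.
elim: k c => [|k IH] c; split=> //; try by move=> x _; apply: cst_continuous.
move=> i; split; first by move=> x _; apply: derivable_cst.
apply: (Ck_eq_on _ (IH 0)) => y _; rewrite /partial derive_cst //.
Qed.

Lemma CkD k f h : Ck_on k U f -> Ck_on k U h -> Ck_on k U (f \+ h).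
Proof.
elim: k f h => [|k IH] f h [cf df] [ch dh]; split=> //;
  try by move=> x Ux; apply: continuousD; [apply: cf|apply: ch].
move=> i; have [df' kf] := df i; have [dh' kh] := dh i; split.
  by move=> x Ux; apply: derivableD; [apply: df'|apply: dh'].
apply: (Ck_eq_on _ (IH _ _ kf kh)) => y Uy.
by rewrite /partial deriveD; [|apply: df'|apply: dh'].
Qed.

Lemma CkM k f h : Ck_on k U f -> Ck_on k U h -> Ck_on k U (f \* h).
Proof.
elim: k f h => [|k IH] f h Hf Hh; have [cf df] := Hf; have [ch dh] := Hh;
  split=> //;
  try by move=> x Ux; apply: continuousM; [apply: cf|apply: ch].
move=> i; have [df' kf] := df i; have [dh' kh] := dh i; split.
  by move=> x Ux; apply: derivableM; [apply: df'|apply: dh'].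
have kf0 := Ck_on_pred Hf; have kh0 := Ck_on_pred Hh.
apply: (Ck_eq_on _ (CkD (IH _ _ kf0 kh) (IH _ _ kh0 kf))) => y Uy.
by rewrite /partial deriveM; [|apply: df'|apply: dh'].
Qed.

Lemma CkN k f : Ck_on k U f -> Ck_on k U (\- f).
Proof.
move=> kf; apply: Ck_eq_on (CkM (Ck_cst k (-1)) kf) => y _ /=.
by rewrite mulN1r.
Qed.

Lemma CkV k f : (forall x, U x -> f x != 0) -> Ck_on k U f ->
  Ck_on k U (fun x => (f x)^-1).
Proof.
move=> f0; elim: k => [|k IH] Hf; have [cf df] := Hf; split=> //;
  try by move=> x Ux; apply: continuousV; [apply: f0|apply: cf].
move=> i; have [df' kf] := df i; split.
  by move=> x Ux; apply: derivableV; [apply: f0|apply: df'].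
have kV := IH (Ck_on_pred Hf).
apply: Ck_eq_on (CkN (CkM (CkM kV kV) kf)) => y Uy /=.
rewrite /partial deriveV; [|exact: f0|exact: df'].
by rewrite /GRing.scale /= -exprVn expr2 mulNr.
Qed.

Lemma derive1_expR_comp (h : R -> R) t : derivable h t 1 ->
  'D_1 (expR \o h) t = expR (h t) * 'D_1 h t.
Proof.
move=> dh; rewrite -!derive1E (derive1_comp dh (@derivable_expR R (h t))).
by rewrite derive1E derive_val.
Qed.

Lemma derive_expR_comp f v x : derivable f x v ->
  derivable (fun y => expR (f y)) x v /\
  'D_v (fun y => expR (f y)) x = expR (f x) * 'D_v f x.
Proof.
(* The point [x] is the parameter 0 of its line in direction [v], where the one-variable chain rule
   is applied. *)
have xE : 0 *: v + x = x by rewrite scale0r add0r.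
rewrite -{1}xE => /derivable_line df.
have dc : derivable (expR \o (fun s : R => f (s *: v + x))) 0 1.
  apply/derivable1_diffP/differentiable_comp; first exact/derivable1_diffP.
  exact/derivable1_diffP/derivable_expR.
split.
  by have := (derivable_line (fun y => expR (f y)) v x 0).2 dc; rewrite xE.
have e1 : 'D_v (fun y => expR (f y)) (0 *: v + x)
    = 'D_1 (expR \o (fun s : R => f (s *: v + x))) 0 := derive_line _ v x 0.
have e2 := derive_line f v x 0; rewrite xE in e1 e2.
by rewrite e1 e2 (derive1_expR_comp df) xE.
Qed.

Lemma Ck_expR k f : Ck_on k U f -> Ck_on k U (fun x => expR (f x)).
Proof.
elim: k => [|k IH] Hf; have [cf df] := Hf; split=> //;
  try by move=> x Ux; apply: (@continuous_comp _ _ _ f expR);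
    [apply: cf|apply: continuous_expR].
move=> i; have [df' kf] := df i; split.
  by move=> x Ux; apply: (derive_expR_comp _).1; apply: df'.
apply: Ck_eq_on (CkM (IH (Ck_on_pred Hf)) kf) => y Uy /=.
by rewrite /partial (derive_expR_comp _).2//; apply: df'.
Qed.

Lemma smooth_sum (I : Type) (r : seq I) (F : I -> 'rV[R]_n -> R) :
  (forall i, smooth_on U (F i)) -> smooth_on U (fun x => \sum_(i <- r) F i x).
Proof.
move=> sF k; elim: r => [|i r IH].
  by apply: Ck_eq_on (Ck_cst k 0) => y _ /=; rewrite big_nil.
by apply: Ck_eq_on (CkD (sF i k) IH) => y _ /=; rewrite big_cons.
Qed.

Lemma smooth_prod (I : Type) (r : seq I) (F : I -> 'rV[R]_n -> R) :
  (forall i, smooth_on U (F i)) -> smooth_on U (fun x => \prod_(i <- r) F i x).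
Proof.
move=> sF k; elim: r => [|i r IH].
  by apply: Ck_eq_on (Ck_cst k 1) => y _ /=; rewrite big_nil.
by apply: Ck_eq_on (CkM (sF i k) IH) => y _ /=; rewrite big_cons.
Qed.

Lemma smooth_det m (A : 'rV[R]_n -> 'M[R]_m) :
  (forall i j, smooth_on U (fun x => A x i j)) ->
  smooth_on U (fun x => \det (A x)).
Proof.
move=> sA; apply: smooth_sum => s k.
by apply: CkM (Ck_cst _ _) (smooth_prod _ _ _).
Qed.

(** By Cramer's rule the entries are cofactors divided by a nonvanishing determinant. *)
Lemma smooth_invmx m (A : 'rV[R]_n -> 'M[R]_m) :
  (forall i j, smooth_on U (fun x => A x i j)) ->
  (forall x, U x -> A x \in unitmx) ->
  forall i j, smooth_on U (fun x => invmx (A x) i j).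
Proof.
move=> sA uA i j k.
have sadj : smooth_on U (fun x => \adj (A x) i j).
  move=> l; apply: (@Ck_eq_on _
    (fun x => (-1) ^+ (j + i) * \det (row' j (col' i (A x))))).
    by move=> y _; rewrite mxE.
  apply: CkM (Ck_cst _ _) (smooth_det _ _) => p q.
  move=> l'; apply: Ck_eq_on (sA (lift j p) (lift i q) l') => y _.
  by rewrite !mxE.
have d0 x : U x -> \det (A x) != 0 by move/uA; rewrite unitmxE unitfE.
apply: Ck_eq_on (CkM (CkV d0 (smooth_det sA k)) (sadj k)) => y Uy.
by rewrite /= /invmx uA// [RHS]mxE.
Qed.

End SmoothClosure.

(* The functions smooth on U, identified when they agree on U by requiring them
   to vanish outside U. *)
Record smoothfun (R : realType) (n : nat) (U : set 'rV[R]_n) (oU : open U) :=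
  SmoothFun {
    smf :> 'rV[R]_n -> R;
    smf_smooth : smooth_on U smf;
    smf_out : forall x, ~ U x -> smf x = 0
  }.

Section SmoothFunctionRing.
Context (R : realType) (n : nat) (U : set 'rV[R]_n) (oU : open U).
Local Notation K := (smoothfun oU).
Implicit Types (F H : K).

HB.instance Definition _ := gen_eqMixin K.
HB.instance Definition _ := gen_choiceMixin K.

Lemma smf_eq F H : (forall x, U x -> F x = H x) -> F = H.
Proof.
case: F H => [f sf f0] [h sh h0] /= fh.
have e : f = h.
  by apply/funext => x; have [/fh//|nU] := pselect (U x); rewrite f0// h0.
by subst h; congr SmoothFun; apply: Prop_irrelevance.
Qed.

Definition zero_out (f : 'rV[R]_n -> R) : 'rV[R]_n -> R :=
  fun x => if x \in U then f x else 0.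

Lemma zero_outE f x : U x -> zero_out f x = f x.
Proof. by move=> Ux; rewrite /zero_out mem_set. Qed.

Lemma zero_out_smooth f : smooth_on U f -> smooth_on U (zero_out f).
Proof.
by move=> sf k; apply: Ck_eq_on (sf k) => // y Uy; rewrite zero_outE.
Qed.

Lemma zero_out_out f x : ~ U x -> zero_out f x = 0.
Proof. by move=> nU; rewrite /zero_out memNset. Qed.

Definition mk_smf f (sf : smooth_on U f) : K :=
  SmoothFun oU (zero_out_smooth sf) (@zero_out_out f).

Lemma mk_smfE f (sf : smooth_on U f) x : U x -> mk_smf sf x = f x.
Proof. exact: zero_outE. Qed.

Definition smf_zero : K := mk_smf (fun k => Ck_cst oU k 0).
Definition smf_one : K := mk_smf (fun k => Ck_cst oU k 1).
Definition smf_add F H : K :=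
  mk_smf (fun k => CkD oU (smf_smooth F k) (smf_smooth H k)).
Definition smf_opp F : K := mk_smf (fun k => CkN oU (smf_smooth F k)).
Definition smf_mul F H : K :=
  mk_smf (fun k => CkM oU (smf_smooth F k) (smf_smooth H k)).

Lemma add_smfE F H x : U x -> smf_add F H x = F x + H x.
Proof. exact: mk_smfE. Qed.

Lemma opp_smfE F x : U x -> smf_opp F x = - F x.
Proof. exact: mk_smfE. Qed.

Lemma mul_smfE F H x : U x -> smf_mul F H x = F x * H x.
Proof. exact: mk_smfE. Qed.

Lemma zero_smfE x : U x -> smf_zero x = 0.
Proof. exact: mk_smfE. Qed.

Lemma one_smfE x : U x -> smf_one x = 1.
Proof. exact: mk_smfE. Qed.

Let opE := (add_smfE, opp_smfE, mul_smfE, zero_smfE, one_smfE).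

Let addA : associative smf_add.
Proof. by move=> F G H; apply: smf_eq => x Ux; rewrite !opE// addrA. Qed.
Let addC : commutative smf_add.
Proof. by move=> F G; apply: smf_eq => x Ux; rewrite !opE// addrC. Qed.
Let add0 : left_id smf_zero smf_add.
Proof. by move=> F; apply: smf_eq => x Ux; rewrite !opE// add0r. Qed.
Let addN : left_inverse smf_zero smf_opp smf_add.
Proof. by move=> F; apply: smf_eq => x Ux; rewrite !opE// addNr. Qed.
Let mulA : associative smf_mul.
Proof. by move=> F G H; apply: smf_eq => x Ux; rewrite !opE// mulrA. Qed.
Let mulC : commutative smf_mul.
Proof. by move=> F G; apply: smf_eq => x Ux; rewrite !opE// mulrC. Qed.
Let mul1 : left_id smf_one smf_mul.
Proof. by move=> F; apply: smf_eq => x Ux; rewrite !opE// mul1r. Qed.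
Let mulD : left_distributive smf_mul smf_add.
Proof. by move=> F G H; apply: smf_eq => x Ux; rewrite !opE// mulrDl. Qed.

HB.instance Definition _ := GRing.isZmodule.Build K addA addC add0 addN.
HB.instance Definition _ :=
  GRing.Zmodule_isComPzRing.Build K mulA mulC mul1 mulD.

Lemma smf0 x : (0 : K) x = 0.
Proof.
by have [Ux|nU] := pselect (U x); [apply: zero_smfE|rewrite smf_out].
Qed.

Lemma smf1 x : U x -> (1 : K) x = 1.
Proof. exact: one_smfE. Qed.

(** Valid at every point, as both sides vanish outside [U]; the unit is the exception, whence the
    assumption of [smf1]. *)
Lemma smfD F H x : (F + H) x = F x + H x.
Proof.
have [Ux|nU] := pselect (U x); first exact: add_smfE.
by rewrite !smf_out// addr0.
Qed.

Lemma smfN F x : (- F) x = - F x.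
Proof.
have [Ux|nU] := pselect (U x); first exact: opp_smfE.
by rewrite !smf_out// oppr0.
Qed.

Lemma smfM F H x : (F * H) x = F x * H x.
Proof.
have [Ux|nU] := pselect (U x); first exact: mul_smfE.
by rewrite !smf_out// mulr0.
Qed.

Lemma smf_sum (I : Type) (r : seq I) (F : I -> K) x :
  (\sum_(i <- r) F i) x = \sum_(i <- r) F i x.
Proof.
by apply: (big_morph (fun F : K => F x) _ (smf0 x)) => F1 F2; exact: smfD.
Qed.

Lemma smooth_partial i f : smooth_on U f -> smooth_on U (partial i f).
Proof. by move=> sf k; have [_ /(_ i)[]] := sf k.+1. Qed.

End SmoothFunctionRing.

(* Locked: otherwise unification unfolds derivations down to limits. *)
HB.lock Definition sder (R : realType) (n : nat) (U : set 'rV[R]_n)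
  (oU : open U) (i : 'I_n) (F : smoothfun oU) : smoothfun oU :=
  mk_smf oU (smooth_partial i (smf_smooth F)).

Section SmoothFunctionDerivations.
Context (R : realType) (n : nat) (U : set 'rV[R]_n) (oU : open U).
Local Notation K := (smoothfun oU).
Implicit Types (F H : K).


Lemma sderE i F x : U x -> sder i F x = partial i F x.
Proof. by move=> Ux; rewrite sder.unlock mk_smfE. Qed.

(** Carries the identification of a coordinate expression with a ring element through one
    derivative; iterating it translates the curvature formulas. *)
Lemma partial_smf i f F : (forall y, U y -> f y = F y) ->
  forall x, U x -> partial i f x = sder i F x.
Proof.
move=> fF x Ux; rewrite sderE//.
exact: (partial_eq_on oU i fF Ux).
Qed.

Lemma smooth_derivable i f x :
  smooth_on U f -> U x -> derivable f x (delta_mx 0 i).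
Proof. by move=> sf Ux; have [_ /(_ i)[+ _]] := sf 1; apply. Qed.

Lemma sderD i F H : sder i (F + H) = sder i F + sder i H.
Proof.
apply: smf_eq => x Ux; rewrite smfD -(@partial_smf _ (F \+ H))//.
  by rewrite /partial deriveD ?sderE//;
    apply: smooth_derivable Ux; apply: smf_smooth.
by move=> y _; rewrite smfD.
Qed.

Lemma sderM i F H : sder i (F * H) = sder i F * H + F * sder i H.
Proof.
apply: smf_eq => x Ux; rewrite smfD !smfM -(@partial_smf _ (F \* H))//.
  rewrite /partial deriveM ?sderE//;
    try by apply: smooth_derivable Ux; apply: smf_smooth.
  by rewrite addrC; congr (_ + _); apply: mulrC.
by move=> y _; rewrite smfM.
Qed.

Lemma sderC i j F : sder i (sder j F) = sder j (sder i F).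
Proof.
have sF := smf_smooth F.
have E k l x : U x -> sder k (sder l F) x = partial k (partial l F) x.
  move=> Ux; rewrite -(@partial_smf _ (partial l F))// => y.
  exact: partial_smf.
apply: smf_eq => x Ux; apply: etrans (E i j x Ux) _.
apply: etrans _ (esym (E j i x Ux)).
have C k l : {for x, continuous (partial k (partial l F))}.
  by have [c _] := smooth_partial k (smooth_partial l sF) 0; apply: c.
apply: (derive_comm oU Ux _ (C i j) (C j i)) => y Uy.
have Dy f k : smooth_on U f -> derivable f y (delta_mx 0 k).
  by move=> sf; apply: smooth_derivable Uy.
split; [exact: (Dy F j sF)|exact: (Dy F i sF)| |].
  exact: (Dy _ i (smooth_partial j sF)).
exact: (Dy _ j (smooth_partial i sF)).
Qed.

End SmoothFunctionDerivations.

(** * Positive definite matrices *)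

Section PositiveDefinite.
Context (R : rcfType).

(** Symmetric Gaussian elimination, by induction on the size. *)
Lemma posdef_congruent1 n (A : 'M[R]_n) : A^T = A ->
  (forall v : 'rV[R]_n, v != 0 -> 0 < (v *m A *m v^T) 0 0) ->
  exists L : 'M[R]_n, L *m A *m L^T = 1%:M.
Proof.
elim: n A => [|n IH] A; first by exists 1%:M; rewrite [LHS]flatmx0 [RHS]flatmx0.
rewrite -[n.+1]/(1 + n)%N in A * => Asym Apos.
pose a := ulsubmx A 0 0; pose b : 'rV_n := ursubmx A; pose D := drsubmx A.
have AE : A = block_mx a%:M b b^T D.
  by rewrite -mx11_scalar trmx_ursub Asym submxK.
have Dsym : D^T = D by rewrite trmx_drsub Asym.
have a0 : 0 < a.
  have v0 : row_mx 1%:M 0 != 0 :> 'rV[R]_(1 + n).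
    by rewrite row_mx_eq0 negb_and oner_neq0.
  have := Apos _ v0; rewrite AE mul_row_block tr_row_mx mul_row_col.
  by rewrite !mul0mx !mul1mx !addr0 trmx0 mulmx0 addr0 trmx1 mulmx1 mxE mulr1n.
(* [B] is the Schur complement of the corner [a]; [T] clears the first column and its transpose the
   first row. *)
pose B := D - a^-1 *: (b^T *m b).
pose T : 'M[R]_(1 + n) := block_mx 1%:M 0 (- (a^-1 *: b^T)) 1%:M.
have TAT : T *m A *m T^T = block_mx a%:M 0 0 B.
  rewrite AE /T tr_block_mx !mulmx_block !mul1mx !mul0mx !addr0 !trmx1 !trmx0.
  rewrite !mulmx1 !mulmx0 !addr0 linearN linearZ /= trmxK.
  rewrite !mulNmx !mulmxN mul_scalar_mx -!scalemxAl -!scalemxAr mul_mx_scalar.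
  rewrite !scalerA mulfV ?mulVf ?gt_eqF// !scale1r !addNr.
  by rewrite mul0mx scaler0 oppr0 add0r addrC.
have Bsym : B^T = B.
  by rewrite /B linearB /= linearZ /= trmx_mul trmxK Dsym.
have [|M MB] := IH B Bsym.
  (* Positivity of [B] at [w] is positivity of [A] at [row_mx 0 w *m T]. *)
  move=> w w0; have v0 : row_mx 0 w *m T != 0.
    rewrite /T mul_row_block mul0mx add0r mulmx0 mulmx1 add0r row_mx_eq0.
    by rewrite negb_and w0 orbT.
  have := Apos _ v0; rewrite trmx_mul -!mulmxA (mulmxA A) (mulmxA T) (mulmxA T).
  rewrite TAT mulmxA mul_row_block tr_row_mx mul_row_col !mul0mx mulmx0 trmx0.
  by rewrite ?mulmx0 ?add0r mulmxA.
pose S : 'M[R]_(1 + n) := block_mx (Num.sqrt a)^-1%:M 0 0 M.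
exists (S *m T); rewrite trmx_mul -!mulmxA (mulmxA A) (mulmxA T) (mulmxA T) TAT.
rewrite mulmxA /S tr_block_mx !mulmx_block !mul0mx !mulmx0 !addr0 !add0r.
rewrite !trmx0 !mulmx0 !mul0mx !addr0 !add0r MB tr_scalar_mx -!scalar_mxM.
rewrite -{2}(sqr_sqrtr (ltW a0)) expr2 mulrA mulVf ?mul1r; last first.
  by rewrite gt_eqF// sqrtr_gt0.
by rewrite mulfV ?gt_eqF ?sqrtr_gt0// -scalar_mx_block.
Qed.

Lemma posdef_unit n (A : 'M[R]_n) :
  (forall v : 'rV[R]_n, v != 0 -> 0 < (v *m A *m v^T) 0 0) -> A \in unitmx.
Proof.
move=> Apos; rewrite -row_free_unit; apply/inj_row_free => v vA.
apply/eqP/negPn/negP => /Apos.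
by rewrite vA mul0mx mxE ltxx.
Qed.

(** Writing the inverse of [A] as [L^T *m L] turns the trace into the sum of the squared entries of
    [L *m E *m L^T]. *)
Lemma trace_contraction_ge0 n (A E : 'M[R]_n) : A^T = A ->
  (forall v : 'rV[R]_n, v != 0 -> 0 < (v *m A *m v^T) 0 0) ->
  0 <= \tr (invmx A *m E *m (invmx A *m E^T)).
Proof.
move=> Asym Apos; have [L LAL] := posdef_congruent1 Asym Apos.
have -> : invmx A = L^T *m L.
  have uA := posdef_unit Apos.
  rewrite -[RHS]mul1mx -(mulVmx uA) -!mulmxA [A *m _]mulmxA.
  by rewrite (mulmx1C (_ : L *m (A *m L^T) = 1%:M)) ?mulmx1// mulmxA.
have -> : \tr (L^T *m L *m E *m (L^T *m L *m E^T))
    = \tr ((L *m E *m L^T) *m (L *m E *m L^T)^T).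
  by rewrite !trmx_mul trmxK -!mulmxA [LHS]mxtrace_mulC !mulmxA.
rewrite /mxtrace sumr_ge0// => i _; rewrite mxE sumr_ge0// => j _.
by rewrite [_^T _ _]mxE -expr2 sqr_ge0.
Qed.

End PositiveDefinite.

(** * Curvature in a chart *)

Section CoordinateIdentity.
Context (R : realType) (n : nat) (U : set 'rV[R]_n) (oU : open U).
Context (g : 'rV[R]_n -> 'M[R]_n).
Context (g_smooth : forall i j, smooth_on U (fun x => g x i j)).
Context (g_sym : forall x, U x -> (g x)^T = g x).
Context (g_unit : forall x, U x -> g x \in unitmx).

Local Notation K := (smoothfun oU).
Local Notation der := (@sder R n U oU).

Definition metric_smf : 'M[K]_n := \matrix_(i, j) mk_smf oU (g_smooth i j).

Definition inverse_smf : 'M[K]_n :=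
  \matrix_(i, j) mk_smf oU (smooth_invmx oU g_smooth g_unit i j).

Definition const_smf (c : R) : K := mk_smf oU (fun k => Ck_cst oU k c).

Local Notation G := metric_smf.
Local Notation H := inverse_smf.
Local Notation half := (const_smf 2^-1).
Local Notation conn := (conn der G H half).
Local Notation curv := (curv der G H half).
Local Notation ricK := (ricK der G H half).
Local Notation scalK := (scalK der G H half).

Lemma metric_smfE i j x : U x -> G i j x = g x i j.
Proof. by move=> Ux; rewrite mxE mk_smfE. Qed.

Lemma inverse_smfE i j x : U x -> H i j x = invmx (g x) i j.
Proof. by move=> Ux; rewrite mxE mk_smfE. Qed.

Lemma const_smfE c x : U x -> const_smf c x = c.
Proof. exact: mk_smfE. Qed.

Lemma half_smf : half + half = 1.
Proof.
apply: smf_eq => x Ux; rewrite smfD smf1// !const_smfE//.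
by rewrite [RHS](@splitr R 1) div1r.
Qed.

Lemma metric_smf_sym : G^T = G.
Proof.
apply/matrixP => i j; rewrite mxE; apply: smf_eq => x Ux.
by rewrite !metric_smfE// -[in LHS](g_sym Ux) mxE.
Qed.

Lemma metric_smf_inverse : G *m H = 1%:M.
Proof.
apply/matrixP => i j; apply: smf_eq => x Ux; rewrite [in LHS]mxE smf_sum.
have /matrixP/(_ i j) := mulmxV (g_unit Ux); rewrite !mxE => e.
transitivity ((i == j)%:R : R); last by case: (i == j); rewrite ?smf1 ?smf0.
rewrite -e; apply: eq_bigr => k _.
by rewrite smfM metric_smfE// inverse_smfE.
Qed.

Lemma der_const i c : der i (const_smf c) = 0.
Proof.
apply: smf_eq => x Ux; rewrite -(@partial_smf _ _ _ _ i (cst c))//.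
  by rewrite /partial derive_cst smf0.
by move=> y Uy; rewrite const_smfE.
Qed.

Lemma christoffel_smf l i k x : U x -> christoffel g l i k x = conn i l k x.
Proof.
move=> Ux; rewrite mxE smfM const_smfE// smf_sum; congr (_ * _).
apply: eq_bigr => m _; rewrite smfM inverse_smfE// !smfD smfN.
by congr (_ * (_ + _ - _)); apply: partial_smf => // y Uy; rewrite metric_smfE.
Qed.

Lemma riemann_smf l k i j x : U x -> riemann g l k i j x = curv i j l k x.
Proof.
move=> Ux; rewrite curvE !smfD !smfN !smf_sum /riemann sumrB.
congr (_ - _ + (_ - _)).
- by apply: partial_smf => // y Uy; rewrite christoffel_smf.
- by apply: partial_smf => // y Uy; rewrite christoffel_smf.
- by apply: eq_bigr => p _; rewrite smfM !christoffel_smf.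
- by apply: eq_bigr => p _; rewrite smfM !christoffel_smf.
Qed.

Lemma ricci_smf j k x : U x -> ricci g x j k = ricK j k x.
Proof.
move=> Ux; rewrite !mxE smf_sum; apply: eq_bigr => i _.
exact: riemann_smf.
Qed.

Lemma ricci_sym x : U x -> (ricci g x)^T = ricci g x.
Proof.
move=> Ux; apply/matrixP => j k; rewrite [LHS]mxE !ricci_smf//.
rewrite -[in LHS](@ricK_sym K n der) ?mxE//.
- exact: sderD.
- exact: sderM.
- exact: sderC.
- exact: half_smf.
- exact: metric_smf_sym.
- exact: metric_smf_inverse.
Qed.

Lemma scalar_curvature_smf x : U x -> scalar_curvature g x = scalK x.
Proof.
move=> Ux; rewrite smf_sum; apply: eq_bigr => i _; rewrite smf_sum.
by apply: eq_bigr => j _; rewrite smfM ricci_smf// inverse_smfE.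
Qed.

(** The value at [x] of the ring identity [div_traceless_grad], once each coordinate expression is
    matched with a ring element. *)
Lemma div_traceless_gradient u x : smooth_on U u -> U x ->
  divergence g (apply_sharp g (traceless_ricci g) (gradient g u)) x
  = (2^-1 - n%:R^-1) * lie_derivative (gradient g u) (scalar_curvature g) x
    + \tr (invmx (g x) *m traceless_ricci g x
           *m (invmx (g x) *m (hessian g u x)^T)).
Proof.
move=> su Ux; pose uK : K := mk_smf oU su.
have uE y : U y -> u y = uK y by move=> Uy; rewrite mk_smfE.
pose ninv := const_smf n%:R^-1.
pose E : 'M[K]_n := ricK - (ninv * scalK) *: G.
have EE i j y : U y -> traceless_ricci g y i j = E i j y.
  move=> Uy; rewrite /traceless_ricci /E !addmxE !oppmxE smfD smfN.
  rewrite ricci_smf// !scalemxE !smfM.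
  rewrite metric_smfE// const_smfE// scalar_curvature_smf//.
  by congr (_ - _ * _); apply: mulrC.
have gradE k y : U y -> gradient g u y 0 k = gradK der H uK k 0 y.
  move=> Uy; rewrite !mxE smf_sum; apply: eq_bigr => j _.
  rewrite smfM inverse_smfE// mxE; congr (_ * _).
  exact: partial_smf.
have XE i y : U y -> apply_sharp g (traceless_ricci g) (gradient g u) y 0 i
    = (H *m E *m gradK der H uK) i 0 y.
  move=> Uy; rewrite mxE -mulmxA mulmx_sumE smf_sum; apply: eq_bigr => j _.
  rewrite smfM mulmx_sumE smf_sum mulr_sumr; apply: eq_bigr => k _.
  by rewrite smfM gradE// EE// inverse_smfE// mulrA.
have hessE i l : hessian g u x i l = hessK der G H half uK i l x.
  rewrite !mxE smfD smfN smf_sum; congr (_ - _).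
    by apply: partial_smf => // y Uy; apply: partial_smf.
  apply: eq_bigr => k _; rewrite smfM christoffel_smf//; congr (_ * _).
  exact: partial_smf.
have -> : divergence g (apply_sharp g (traceless_ricci g) (gradient g u)) x
    = divK der G H half (H *m E *m gradK der H uK) x.
  rewrite smf_sum; apply: eq_bigr => i _; rewrite smfD smf_sum; congr (_ + _).
    by apply: partial_smf => // y Uy; rewrite XE.
  by apply: eq_bigr => j _; rewrite smfM christoffel_smf// XE.
rewrite (@div_traceless_grad K n der) ?smfD ?smfM ?smfN//; first congr (_ + _).
- rewrite smfD smfN !const_smfE// smf_sum; congr (_ * _).
  apply: eq_bigr => k _; rewrite smfM gradE//; congr (_ * _).
  by apply/esym/partial_smf => // y Uy; rewrite scalar_curvature_smf.
- rewrite smf_sum; apply: eq_bigr => i _; rewrite !mulmx_sumE smf_sum.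
  apply: eq_bigr => k _; rewrite smfM; congr (_ * _).
    rewrite !mulmx_sumE smf_sum; apply: eq_bigr => p _.
    by rewrite smfM EE// inverse_smfE.
  rewrite !mulmx_sumE smf_sum; apply: eq_bigr => l _.
  by rewrite smfM inverse_smfE// !trmxE hessE.
- exact: sderD.
- exact: sderM.
- exact: sderC.
- exact: half_smf.
- exact: metric_smf_sym.
- exact: metric_smf_inverse.
- by move=> i; apply: der_const.
Qed.

Lemma trace_traceless_ricci x : (0 < n)%N -> U x ->
  \tr (invmx (g x) *m traceless_ricci g x) = 0.
Proof.
move=> n0 Ux; rewrite /traceless_ricci mulmxBr -scalemxAr mulVmx ?g_unit//.
rewrite linearB linearZ /= mxtrace1 divfK ?pnatr_eq0 -?lt0n//.
apply/eqP; rewrite subr_eq0; apply/eqP/eq_bigr => i _; rewrite mxE.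
by apply: eq_bigr => j _; rewrite -[in LHS](ricci_sym Ux) mxE.
Qed.

Lemma tensor_inner_trace h x : U x ->
  tensor_inner g h h x
  = \tr (invmx (g x) *m h x *m (invmx (g x) *m (h x)^T)).
Proof.
move=> Ux; have isym i j : invmx (g x) i j = invmx (g x) j i.
  by rewrite -[in LHS](g_sym Ux) -trmx_inv mxE.
rewrite /tensor_inner /mxtrace.
(* This is the order of summation in which the trace of the product unfolds. *)
transitivity (\sum_k \sum_j \sum_i \sum_l
    invmx (g x) i k * invmx (g x) j l * h x i j * h x k l).
  under eq_bigr do rewrite exchange_big /=; rewrite exchange_big /=.
  by under eq_bigr do rewrite exchange_big /=.
apply: eq_bigr => k _; rewrite mxE; apply: eq_bigr => j _.
rewrite !mxE mulr_suml; apply: eq_bigr => i _; rewrite mulr_sumr.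
by apply: eq_bigr => l _; rewrite mxE (isym i k); ring.
Qed.

(** For $c = \mu/\beta$ the bracket is the left-hand side of the Einstein-type equation without its
    Ricci term, divided by $\beta$. *)
Lemma hessian_expR f c x : smooth_on U f -> U x ->
  hessian g (fun y => expR (c * f y)) x
  = (c * expR (c * f x)) *: (hessian g f x + c *: differential_sq f x).
Proof.
move=> sf Ux; have df i y : U y -> derivable f y (delta_mx 0 i).
  exact: smooth_derivable.
have P i y : U y -> partial i (fun z => expR (c * f z)) y
    = c * (expR (c * f y) * partial i f y).
  move=> Uy.
  have dcf : derivable (c \*: f) y (delta_mx 0 i) by apply/derivableZ/df.
  rewrite /partial (derive_expR_comp dcf).2 deriveZ; last exact: df.
  by rewrite /GRing.scale /=; ring.
have se : smooth_on U (fun z => expR (c * f z)).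
  by move=> k; apply: (Ck_expR oU); apply: CkM => //; apply: Ck_cst.
have PP i j : partial i (partial j (fun z => expR (c * f z))) x
    = c * expR (c * f x) * (partial i (partial j f) x
                            + c * (partial i f x * partial j f x)).
  pose e z := expR (c * f z).
  rewrite (@partial_eq_on _ _ _ oU i _ (c \*: (e * partial j f)))//.
    rewrite /partial deriveZ; last first.
      apply: derivableM; first exact: (smooth_derivable se Ux).
      exact: (smooth_derivable (smooth_partial j sf) Ux).
    rewrite deriveM; [|exact: (smooth_derivable se Ux)|].
      rewrite (P i x Ux : 'D_(delta_mx 0 i) _ x = _).
      by rewrite /e /partial /GRing.scale /=; ring.
    exact: (smooth_derivable (smooth_partial j sf) Ux).
  by move=> y Uy; apply: P.
apply/matrixP => i j; rewrite !mxE PP big_ord1 !mxE.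
under eq_bigr do rewrite P//.
have -> : \sum_k christoffel g k i j x * (c * (expR (c * f x) * partial k f x))
    = c * expR (c * f x) * \sum_k christoffel g k i j x * partial k f x.
  by rewrite mulr_sumr; apply: eq_bigr => k _; ring.
by ring.
Qed.

End CoordinateIdentity.

(** * The divergence identity in each chart of the manifold *)

Theorem mainTheorem5 (R : realType) (n : nat) (hn : (3 <= n)%N)
    (M : smoothManifold R n) (hM : connected [set: M])
    (g : riemannianMetric M)
    (f lambda : M -> R)
    (f_smooth : smooth_function f) (lambda_smooth : smooth_function lambda)
    (alpha beta mu rho : R) (beta_neq0 : beta != 0) (mu_neq0 : mu != 0)
    (hE : gradient_einstein_type g f lambda alpha beta mu rho) :
  let u : M -> R := fun p => expR (mu / beta * f p) in
  forall (a : chart M) (p : M), chart_dom a p ->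
    let x := chart_coord a p in
    let grad_u := gradient (g a) (in_chart u a) in
    divergence (g a) (apply_sharp (g a) (traceless_ricci (g a)) grad_u) x
    = (n%:R - 2) / (2 * n%:R)
        * lie_derivative grad_u (scalar_curvature (g a)) x
      - alpha * mu / beta ^+ 2 * u p
        * tensor_norm (g a) (traceless_ricci (g a)) x ^+ 2.
Proof.
move=> u a p ap x grad_u; pose U := chart_coord a @` chart_dom a.
have oU : open U by exact: image_open.
have Ux : U x by exists p.
have gs := @metric_smooth _ _ _ g a; have gsym := @Defs.metric_sym _ _ _ g a.
have gpos := @metric_posdef _ _ _ g a.
have gu y : U y -> g a y \in unitmx by move=> Uy; apply/posdef_unit/gpos.
have sf := f_smooth a.
have su : smooth_on U (in_chart u a).
  by move=> k; apply: (Ck_expR oU); apply: (CkM oU) => //; apply: (Ck_cst oU).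
have n0 : (0 < n)%N by apply: leq_trans hn.
have nR0 : n%:R != 0 :> R by rewrite pnatr_eq0 -lt0n.
(* The scalar curvature terms agree since $1/2 - 1/n = (n-2)/(2n)$; the trace against the Hessian
   remains. *)
rewrite (div_traceless_gradient oU gs gsym gu su Ux) -/grad_u; congr (_ + _).
  by congr (_ * _); field; rewrite nR0.
set E := traceless_ricci (g a).
(* Squaring undoes [Num.sqrt] only on nonnegative numbers, hence the appeal to positive
   definiteness. *)
have -> : tensor_norm (g a) E x ^+ 2
    = \tr (invmx (g a x) *m E x *m (invmx (g a x) *m (E x)^T)).
  rewrite /tensor_norm sqr_sqrtr (tensor_inner_trace gsym _ Ux)//.
  exact: trace_contraction_ge0 (gsym _ Ux) (gpos _ Ux).
have fp : in_chart f a x = f p by rewrite /in_chart coordK.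
(* [kappa] is the factor $(\mu/\beta) u$ of the Hessian of the exponential, divided by $\beta$.
   Below, $Ric = E + (S/n) g$ separates the multiples of the metric from those of [E]. *)
pose kappa := mu / beta ^+ 2 * u p.
have -> : hessian (g a) (in_chart u a) x
    = (kappa * (rho * scalar_curvature (g a) x + lambda p
                - alpha * (scalar_curvature (g a) x / n%:R))) *: g a x
      - (alpha * kappa) *: E x.
  rewrite (hessian_expR oU (g a) (mu / beta) sf Ux) fp -/(u p).
  have /matrixP HE := hE a p ap; apply/matrixP => i j; have {HE} := HE i j.
  rewrite -/x /E /traceless_ricci.
  move: (hessian _ _ _) (differential_sq _ _) (ricci _ _).
  move: (scalar_curvature _ _).
  move=> s Hf Df Rc; rewrite !(addmxE, oppmxE, scalemxE) => HE.
  have -> : Hf i j + mu / beta * Df i j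
      = beta^-1 * ((rho * s + lambda p) * g a x i j - alpha * Rc i j).
    by rewrite -HE; field.
  by rewrite /kappa; field; rewrite ?nR0 ?beta_neq0.
have trE (c d : R) : (c *: g a x - d *: E x)^T = c *: g a x - d *: (E x)^T.
  by rewrite linearB /= !linearZ /= gsym.
have tr0 : \tr (invmx (g a x) *m E x) = 0.
  by have := trace_traceless_ricci oU gs gsym gu n0 Ux; apply.
rewrite trE; move: (E x) tr0 => Ex tr0.
(* The metric part contributes a multiple of [\tr (invmx (g a x) *m Ex)], which is zero, so only the
   term in [- (alpha * kappa)] survives. *)
rewrite (mulmxBr (invmx _)) -!scalemxAr mulVmx ?gu// mulmxBr -!scalemxAr mulmx1.
by rewrite raddfB /= !mxtraceZ tr0 mulr0 add0r /kappa !mulrA.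
Qed.
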